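(* Let $X\in\{\mathrm{FL},\,k\mathrm{M},\,k\mathrm{FL}\}$. Suppose there is a polynomial-time $\alpha$-approximation algorithm for ConPFL (connected prize-collecting facility location), and a polynomial-time algorithm for the capacitated prize-collecting problem CP$X$ (i.e. CPFL, CP$k$M or CP$k$FL) that returns a solution of cost at most $\beta$ times the optimal cost of CP$X$ while violating the capacities (respectively the cardinality bound) by a factor of at most $\gamma$. Then there is a polynomial-time algorithm for ConCP$X$ (i.e. ConCPFL, ConCP$k$M or ConCP$k$FL) that returns a solution of cost at most $(\alpha+2\beta)$ times the optimal cost of ConCP$X$, violating the capacities (respectively the cardinality bound) by a factor of at most $\gamma$.
   Context: An instance consists of a finite set $V$ with a metric $c:V\times V\to\mathbb{R}_{\ge 0}$, facilities $\mathcal{F}\subseteq V$ with opening costs $f_i\ge0$, and clients $\mathcal{C}\subseteq V$. In prize-collecting variants (letter P) each client $j$ has a penalty $p_j\ge0$; a solution opens $\mathcal{F}'\subseteq\mathcal{F}$, chooses a set $\mathcal{C}_p\subseteq\mathcal{C}$ of clients that pay their penalty, and assigns the others by $\phi:\mathcal{C}\setminus\mathcal{C}_p\to\mathcal{F}'$; the cost is $\sum_{i\in\mathcal{F}'}f_i+\sum_{j\in\mathcal{C}\setminus\mathcal{C}_p}c(j,\phi(j))+\sum_{j\in\mathcal{C}_p}p_j$. PFL minimises this cost. $k$FL variants additionally require $|\mathcal{F}'|\le k$ for a given $k$; $k$M variants are $k$FL variants with all $f_i=0$. Capacitated variants (C): each facility has capacity $u_i$ and $|\phi^{-1}(i)|\le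 u_i$ is required. Connected variants (Con): the solution additionally specifies a Steiner tree $T$ in the complete graph on $V$ containing all of $\mathcal{F}'$, and $\sum_{e\in T}c(e)$ is added to the cost. ConPFL is connected PFL without capacities or cardinality bound. An algorithm is a $\beta$-approximation with $\gamma$-factor violation in capacities (resp. cardinality) if it returns a solution satisfying all constraints except that $|\phi^{-1}(i)|\le\gamma u_i$ (resp. $|\mathcal{F}'|\le\gamma k$), with cost at most $\beta$ times the optimum of the unviolated problem. *)

(* Defs.v *)
From Corelib Require Import BinNums.
From mathcomp Require Import all_boot all_order all_algebra.
From mathcomp Require Import boolp reals.

Set Implicit Arguments.
Unset Strict Implicit.
Unset Printing Implicit Defensive.

Import Order.TTheory GRing.Theory Num.Theory.
Local Open Scope ring_scope.

(** Neil Jones's WHILE language over binary trees, in three-address form.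
    Every assignment is charged the full size of the tree it stores (no credit
    for sharing), so that a run of cost t builds only trees of total size at
    most t.  Up to a polynomial this is Turing-machine time: a tape is a list,
    and conversely each step rewrites trees already paid for or given as
    input. *)

Inductive data := Nil | Cons of data & data.

Fixpoint dsize (d : data) : nat :=
  if d is Cons a b then (dsize a + dsize b).+1 else 1%N.

Definition dhead (d : data) : data := if d is Cons a _ then a else Nil.
Definition dtail (d : data) : data := if d is Cons _ b then b else Nil.

Definition store := nat -> data.

Definition update (s : store) (x : nat) (d : data) : store :=
  fun y => if y == x then d else s y.

Inductive expr :=
  | ENil
  | EVar of nat
  | ECons of nat & nat
  | EHead of nat
  | ETail of nat.

Definition eval (s : store) (e : expr) : data :=
  match e with
  | ENil => Nil
  | EVar y => s y
  | ECons y z => Cons (s y) (s z)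
  | EHead y => dhead (s y)
  | ETail y => dtail (s y)
  end.

Inductive program :=
  | Assign of nat & expr
  | Seq of program & program
  | If of nat & program & program
  | While of nat & program.

(** [exec c s s' t]: from store [s], the program [c] halts in store [s'] after
    time [t]; a test succeeds when the variable does not hold [Nil]. *)
Inductive exec : program -> store -> store -> nat -> Prop :=
  | ExecAssign x e s :
      exec (Assign x e) s (update s x (eval s e)) (dsize (eval s e))
  | ExecSeq c1 c2 s s1 s2 t1 t2 :
      exec c1 s s1 t1 -> exec c2 s1 s2 t2 ->
      exec (Seq c1 c2) s s2 (t1 + t2)
  | ExecIfTrue x c1 c2 s s1 t :
      s x <> Nil -> exec c1 s s1 t -> exec (If x c1 c2) s s1 t.+1
  | ExecIfFalse x c1 c2 s s1 t :
      s x = Nil -> exec c2 s s1 t -> exec (If x c1 c2) s s1 t.+1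
  | ExecWhileDone x c s :
      s x = Nil -> exec (While x c) s s 1
  | ExecWhileStep x c s s1 s2 t1 t2 :
      s x <> Nil -> exec c s s1 t1 -> exec (While x c) s1 s2 t2 ->
      exec (While x c) s s2 (t1 + t2).+1.

(** The input is passed and the output returned in variable 0; all other
    variables initially hold [Nil]. *)
Definition computes (c : program) (input output : data) (t : nat) : Prop :=
  exists2 s, exec c (update (fun=> Nil) 0 input) s t & s 0%N = output.

Definition enc_bool (b : bool) : data := if b then Cons Nil Nil else Nil.

Definition enc_option (T : Type) (e : T -> data) (o : option T) : data :=
  if o is Some x then Cons Nil (e x) else Nil.

Definition enc_fun (n : nat) (e : 'I_n -> data) : data :=
  foldr Cons Nil [seq e i | i <- enum 'I_n].

(** Binary, least significant bit first; the leading 1 is implicit. *)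
Fixpoint enc_pos (p : positive) : data :=
  match p with
  | xH => Nil
  | xO q => Cons (enc_bool false) (enc_pos q)
  | xI q => Cons (enc_bool true) (enc_pos q)
  end.

Definition enc_nat (m : nat) : data :=
  if bin_of_nat m is Npos p then Cons Nil (enc_pos p) else Nil.

(** Only used on nonnegative rationals, hence no sign. *)
Definition enc_rat (q : rat) : data :=
  Cons (enc_nat `|numq q|%N) (enc_nat `|denq q|%N).

(** Vertex names are in unary.  As every instance lists its vertices one by
    one, this affects sizes only polynomially. *)
Definition enc_vertex (n : nat) (i : 'I_n) : data := iter i (Cons Nil) Nil.

Definition enc_set (n : nat) (A : {set 'I_n}) : data :=
  enc_fun (fun i => enc_bool (i \in A)).

Inductive variant := FL | kM | kFL.

Definition bounds_cardinality (X : variant) : bool :=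
  if X is FL then false else true.

Definition free_opening (X : variant) : bool :=
  if X is kM then true else false.

(** All problems are prize-collecting. *)
Record problem := Problem {
  connected : bool;
  capacitated : bool;
  base : variant
}.

Definition ConPFL : problem := Problem true false FL.
Definition CP (X : variant) : problem := Problem false true X.
Definition ConCP (X : variant) : problem := Problem true true X.

(** One record serves all problems.  [open_cost] and [capacity] matter on
    [facilities] only, [penalty] on [clients] only, and [capacity], [bound] only
    for the problems that use them; [enc_instance] hides everything else from
    the algorithms. *)
Record instance := Instance {
  nV : nat;
  dist : 'I_nV -> 'I_nV -> rat;
  facilities : {set 'I_nV};
  open_cost : 'I_nV -> rat;
  clients : {set 'I_nV};
  penalty : 'I_nV -> rat;
  capacity : 'I_nV -> nat;
  bound : nat
}.

Definition metric (n : nat) (d : 'I_n -> 'I_n -> rat) : Prop :=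
  [/\ forall x y, 0 <= d x y,
      forall x y, d x y = 0 <-> x = y,
      forall x y, d x y = d y x
    & forall x y z, d x z <= d x y + d y z].

Definition valid (P : problem) (I : instance) : Prop :=
  [/\ metric (@dist I),
      forall i, i \in facilities I -> 0 <= open_cost i,
      forall j, j \in clients I -> 0 <= penalty j
    & free_opening (base P) ->
      forall i, i \in facilities I -> open_cost i = 0].

(** [assign] is the partial function phi: the clients mapped to [None] pay
    their penalty.  [tree_vertices], [tree_edges] describe the Steiner tree and
    are irrelevant for unconnected problems; an edge {x, y} is recorded once,
    as the pair (x, y) with x < y. *)
Record solution (n : nat) := Solution {
  opened : {set 'I_n};
  assign : {ffun 'I_n -> option 'I_n};
  tree_vertices : {set 'I_n};
  tree_edges : {set 'I_n * 'I_n}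
}.

Definition adjacent (n : nat) (E : {set 'I_n * 'I_n}) : rel 'I_n :=
  fun x y => ((x, y) \in E) || ((y, x) \in E).

(** The graph (W, E) is a tree.  The null graph is allowed: it spans an empty
    set of open facilities at cost 0, as a single vertex would. *)
Definition is_tree (n : nat) (W : {set 'I_n}) (E : {set 'I_n * 'I_n}) : Prop :=
  [/\ forall x y, (x, y) \in E -> [/\ (x < y)%N, x \in W & y \in W],
      {in W &, forall x y, connect (adjacent E) x y}
    & forall s : seq 'I_n, ucycle (adjacent E) s -> (size s <= 2)%N].

Section Solutions.
Variables (P : problem) (I : instance) (S : solution (nV I)).

Definition paying : {set 'I_(nV I)} :=
  [set j in clients I | assign S j == None].

Definition served_by (i : 'I_(nV I)) : {set 'I_(nV I)} :=
  [set j | assign S j == Some i].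

Definition cost : rat :=
  \sum_(i in opened S) open_cost i
  + \sum_(j in clients I) (if assign S j is Some i then dist j i else 0)
  + \sum_(j in paying) penalty j
  + (if connected P then \sum_(e in tree_edges S) dist e.1 e.2 else 0).

(** The constraints of [P], with capacities relaxed by the factor [gcap] and the
    cardinality bound by the factor [gcard]. *)
Definition feasible (R : realType) (gcap gcard : R) : Prop :=
  [/\ opened S \subset facilities I,
      forall j i, assign S j = Some i -> j \in clients I /\ i \in opened S,
      capacitated P ->
        forall i, i \in opened S ->
          #|served_by i|%:R <= gcap * (capacity i)%:R,
      bounds_cardinality (base P) ->
        #|opened S|%:R <= gcard * (bound I)%:R
    & connected P ->
        opened S \subset tree_vertices S /\
        is_tree (tree_vertices S) (tree_edges S)].

End Solutions.

Definition optimal (R : realType) (P : problem) (I : instance)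
    (S : solution (nV I)) : Prop :=
  feasible P S (1 : R) 1 /\
  forall S' : solution (nV I), feasible P S' (1 : R) 1 ->
    cost P S <= cost P S'.

Lemma exists_optimal (R : realType) (P : problem) (I : instance) :
  exists S : solution (nV I), optimal R P S.
Proof.
pose T := ({set 'I_(nV I)} * {ffun 'I_(nV I) -> option 'I_(nV I)} *
           {set 'I_(nV I)} * {set 'I_(nV I) * 'I_(nV I)})%type.
pose mk (t : T) := Solution t.1.1.1 t.1.1.2 t.1.2 t.2.
pose feas := [pred t : T | `[< feasible P (mk t) (1 : R) 1 >]].
pose t0 : T := (set0, [ffun=> None], set0, set0).
have f0 : feas t0.
  apply/asboolP; split => //=; first exact: sub0set.
  - by move=> j i; rewrite ffunE.
  - by move=> _ i; rewrite inE.
  - by move=> _; rewrite cards0 mul1r ler0n.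
  - move=> _; split; first exact: sub0set.
    split => [x y|x y|[|x [|y s]] //]; rewrite ?inE //.
    by rewrite /ucycle /= /adjacent !inE.
have [t /asboolP ft tmin] := arg_minP (fun t => cost P (mk t)) f0.
exists (mk t); split=> // -[O A W E] fS.
by apply: (tmin (O, A, W, E)); apply/asboolP.
Qed.

Definition enc_instance (P : problem) (I : instance) : data :=
  let on (A : {set 'I_(nV I)}) (e : 'I_(nV I) -> data) :=
    enc_fun (fun i => if i \in A then Cons Nil (e i) else Nil) in
  Cons (enc_fun (fun x => enc_fun (fun y => enc_rat (@dist I x y))))
 (Cons (on (facilities I) (fun i => enc_rat (open_cost i)))
 (Cons (on (clients I) (fun j => enc_rat (penalty j)))
 (Cons (if capacitated P
        then on (facilities I) (fun i => enc_nat (capacity i)) else Nil)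
       (if bounds_cardinality (base P) then enc_nat (bound I) else Nil)))).

Definition enc_solution (P : problem) (n : nat) (S : solution n) : data :=
  Cons (enc_set (opened S))
 (Cons (enc_fun (fun j => enc_option (@enc_vertex n) (assign S j)))
       (if connected P then
          Cons (enc_set (tree_vertices S))
               (enc_fun (fun x =>
                  enc_fun (fun y => enc_bool ((x, y) \in tree_edges S))))
        else Nil)).

(** A polynomial-time [beta]-approximation algorithm for [P] that violates
    capacities by a factor at most [gcap] and the cardinality bound by a factor
    at most [gcard]. *)
Definition poly_time_approx (R : realType) (P : problem)
    (beta gcap gcard : R) : Prop :=
  exists (c : program) (p : {poly nat}), forall I : instance, valid P I ->
    exists (S : solution (nV I)) (t : nat),
      [/\ computes c (enc_instance P I) (enc_solution P S) t,
          (t <= p.[dsize (enc_instance P I)])%N,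
          feasible P S gcap gcard
        & forall Sopt : solution (nV I), optimal R P Sopt ->
            ratr (cost P S) <= beta * ratr (cost P Sopt)].

(** Which constraint a gamma-factor violation is about; the other one holds
    exactly. *)
Inductive violation := Capacities | Cardinality.

Definition poly_time_approx_violating (R : realType) (P : problem)
    (v : violation) (beta gamma : R) : Prop :=
  match v with
  | Capacities => poly_time_approx P beta gamma 1
  | Cardinality => poly_time_approx P beta 1 gamma
  end.

(* Main.v *)
Require Import Defs.
From mathcomp Require Import all_boot all_order all_algebra.
From mathcomp Require Import boolp reals.
From mathcomp Require Import zify lra.

(* Lets [Nil] and [Cons] be the constructors of [data] again, not those of
   lists. *)
Import Defs.
Import Order.TTheory GRing.Theory Num.Theory.
Local Open Scope ring_scope.

Set Implicit Arguments.
Unset Strict Implicit.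
Unset Printing Implicit Defensive.

(** Solve ConPFL and CPX on the same instance, obtaining [S1] and [S2].  A client
    pays its penalty if it does so in [S1] or in [S2], and is otherwise served as
    in [S2]; facilities left without clients are closed.  A facility [i] outside
    the tree of [S1] is linked, as a leaf, to the facility that serves in [S1] an
    arbitrary client [j] of [i].  By the triangle inequality this link costs at
    most the connection costs of [j] in [S1] and [S2], and different facilities
    use different clients, so that the total cost is at most
    cost S1 + 2 cost S2.

    The combination requires no arithmetic on distances, only table lookups and
    comparisons of vertex names; its running time is estimated by closing the
    class of families of inputs and outputs related by a polynomial-time program
    under composition, pairing, tests and loops with small accumulators. *)

Lemma dsize_gt0 d : (0 < dsize d)%N.
Proof. by case: d. Qed.

Lemma leq_exp2rW m n k : (m <= n)%N -> (m ^ k <= n ^ k)%N.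
Proof. by case: k => // k; rewrite leq_exp2r. Qed.

(** * Polynomial bounds in the size of the input *)

Section PolyBounded.
Local Open Scope nat_scope.
Variables (T : Type) (i : T -> data).

(** A single power replaces a polynomial: the base is at least 2, so a larger exponent absorbs
    constants, sums and products. *)
Definition poly_bounded (b : T -> nat) : Prop :=
  exists k, forall x, b x <= (dsize (i x)).+1 ^ k.

Lemma poly_bounded_le a b :
  poly_bounded b -> (forall x, a x <= b x) -> poly_bounded a.
Proof. by move=> [k bk] ab; exists k => x; apply: leq_trans (ab x) (bk x). Qed.

Lemma poly_bounded_const m : poly_bounded (fun=> m).
Proof.
exists m => x; apply: leq_trans (ltnW (ltn_expl m (isT : 1 < 2))) _.
by rewrite leq_exp2rW // ltnS dsize_gt0.
Qed.

Lemma poly_bounded_size : poly_bounded (fun x => dsize (i x)).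
Proof. by exists 1 => x; rewrite expn1. Qed.

Lemma poly_bounded_add a b :
  poly_bounded a -> poly_bounded b -> poly_bounded (fun x => a x + b x).
Proof.
move=> [k ak] [l bl]; exists (k + l).+1 => x; set n := (dsize (i x)).+1.
have n_gt1 : 1 < n by rewrite ltnS dsize_gt0.
apply: (@leq_trans (n ^ (k + l) + n ^ (k + l))).
  by apply: leq_add; [apply: leq_trans (ak x) _ | apply: leq_trans (bl x) _];
     rewrite leq_pexp2l // ?leq_addr ?leq_addl.
by rewrite addnn -mul2n expnS leq_mul2r n_gt1 orbT.
Qed.

Lemma poly_bounded_mul a b :
  poly_bounded a -> poly_bounded b -> poly_bounded (fun x => a x * b x).
Proof.
by move=> [k ak] [l bl]; exists (k + l) => x; rewrite expnD leq_mul.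
Qed.

Lemma poly_bounded_exp a k :
  poly_bounded a -> poly_bounded (fun x => a x ^ k).
Proof.
by move=> [l al]; exists (l * k) => x; rewrite expnM leq_exp2rW.
Qed.

End PolyBounded.

Lemma poly_bounded_trans T (i m : T -> data) b :
  poly_bounded i (fun x => dsize (m x)) -> poly_bounded m b -> poly_bounded i b.
Proof.
move=> pm [k bk].
have pm1 := poly_bounded_add pm (poly_bounded_const i 1).
by apply: poly_bounded_le (poly_bounded_exp k pm1) _ => x; rewrite addn1.
Qed.

Lemma exp_as_poly k : exists p : {poly nat}, forall n, p.[n] = (n.+1 ^ k)%N.
Proof.
by exists (('X + 1) ^+ k) => n; rewrite horner_exp !hornerE natrXE -addn1.
Qed.

(** With [exp_as_poly], this translates between single powers and the polynomials of
    [poly_time_approx]. At [n = 0] the base would be 1, but sizes are positive. *)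
Lemma poly_nat_le_exp (p : {poly nat}) :
  exists k, forall n, (0 < n)%N -> (p.[n] <= n.+1 ^ k)%N.
Proof.
elim/poly_ind: p => [|p c [k pk]]; first by exists 0%N => n; rewrite horner0.
exists (k + c).+2 => n n_gt0; rewrite !hornerE ssralg.natrE.
(* Once the factor [n.+1] is split into [n] and 1, one summand dominates [p.[n]] times [n], the
   other dominates [c], as [c < n.+1 ^ c]. *)
apply: (@leq_trans (n.+1 ^ (k + c) * n.+1)); last first.
  by rewrite -expnSr leq_pexp2l.
rewrite mulnSr; apply: leq_add.
  by rewrite leq_mul2r (leq_trans (pk _ n_gt0)) ?orbT // leq_pexp2l ?leq_addr.
apply: leq_trans (ltnW (ltn_expl c (_ : 1 < n.+1)%N)) _ => //.
by rewrite leq_pexp2l ?leq_addl.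
Qed.

(** * Subroutine calls *)

Section Programs.
Local Open Scope nat_scope.

Definition shift_expr (m : nat) (e : expr) : expr :=
  match e with
  | ENil => ENil
  | EVar y => EVar (m + y)
  | ECons y z => ECons (m + y) (m + z)
  | EHead y => EHead (m + y)
  | ETail y => ETail (m + y)
  end.

Fixpoint shift (m : nat) (c : program) : program :=
  match c with
  | Assign x e => Assign (m + x) (shift_expr m e)
  | Seq c1 c2 => Seq (shift m c1) (shift m c2)
  | If x c1 c2 => If (m + x) (shift m c1) (shift m c2)
  | While x c1 => While (m + x) (shift m c1)
  end.

Definition vars_below_expr (n : nat) (e : expr) : bool :=
  match e with
  | ENil => true
  | EVar y | EHead y | ETail y => y < n
  | ECons y z => (y < n) && (z < n)
  end.

Fixpoint vars_below (n : nat) (c : program) : bool :=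
  match c with
  | Assign x e => (x < n) && vars_below_expr n e
  | Seq c1 c2 => vars_below n c1 && vars_below n c2
  | If x c1 c2 => [&& x < n, vars_below n c1 & vars_below n c2]
  | While x c1 => (x < n) && vars_below n c1
  end.

Lemma vars_below_leq m n c : m <= n -> vars_below m c -> vars_below n c.
Proof.
move=> mn; elim: c => [x e|c1 IH1 c2 IH2|x c1 IH1 c2 IH2|x c IH] /=.
- move=> /andP[xm em]; apply/andP; split; first lia.
  by case: e em => //=; lia.
- by move=> /andP[/IH1-> /IH2->].
- by move=> /and3P[/leq_trans-> // /IH1-> /IH2->].
- by move=> /andP[/leq_trans-> // /IH->].
Qed.

(** The bound tells a call how many cells to clear; positivity puts variable 0, which carries input
    and output, among them. *)
Lemma vars_below_exists c : exists2 n, 0 < n & vars_below n c.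
Proof.
elim: c => [x e|c1 [m m0 hm] c2 [n n0 hn]|x c1 [m m0 hm] c2 [n n0 hn]|x c [n n0 hn]].
- case: e => [|y|y z|y|y]; [exists x.+1|exists (x + y).+1|exists (x + y + z).+1|
    exists (x + y).+1|exists (x + y).+1] => //=; lia.
- exists (m + n); first lia.
  by rewrite /= (vars_below_leq _ hm) ?(vars_below_leq _ hn) ?leq_addr ?leq_addl.
- exists (x + m + n).+1 => //=; apply/and3P; split; first lia.
    by apply: vars_below_leq hm; lia.
  by apply: vars_below_leq hn; lia.
- exists (x + n).+1 => //=; apply/andP; split; first lia.
  by apply: vars_below_leq hn; lia.
Qed.

Lemma eval_shift m n e (s sg : store) :
  vars_below_expr n e -> (forall x, x < n -> sg (m + x) = s x) ->
  eval sg (shift_expr m e) = eval s e.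
Proof.
case: e => //= [y yn|y z /andP[yn zn]|y yn|y yn] E; by rewrite !E.
Qed.

(** The shifted program mimics the original step by step on the cells from [m] on. Agreement below
    [n] suffices, since [c] touches no other variable. *)
Lemma exec_shift m n c s s' t : exec c s s' t -> vars_below n c ->
  forall sg : store, (forall x, x < n -> sg (m + x) = s x) ->
  exists sg', [/\ exec (shift m c) sg sg' t,
    forall x, x < n -> sg' (m + x) = s' x & forall y, y < m -> sg' y = sg y].
Proof.
elim=> {c s s' t} /=.
- move=> x e s /andP[xn en] sg E; have Ee := eval_shift en E.
  exists (update sg (m + x) (eval s e)); split.
  + by rewrite -Ee; exact: ExecAssign.
  + by move=> y yn; rewrite /update eqn_add2l E.
  + by move=> y ym; rewrite /update; case: eqP => // ?; lia.
- move=> c1 c2 s s1 s2 t1 t2 _ IH1 _ IH2 /andP[n1 n2] sg E.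
  have [sg1 [e1 E1 F1]] := IH1 n1 sg E.
  have [sg2 [e2 E2 F2]] := IH2 n2 sg1 E1.
  exists sg2; split=> //; first exact: ExecSeq e1 e2.
  by move=> y ym; rewrite F2 ?F1.
- move=> x c1 c2 s s1 t sx _ IH /and3P[xn n1 n2] sg E.
  have [sg1 [e1 E1 F1]] := IH n1 sg E.
  by exists sg1; split=> //; apply: ExecIfTrue => //; rewrite E.
- move=> x c1 c2 s s1 t sx _ IH /and3P[xn n1 n2] sg E.
  have [sg1 [e1 E1 F1]] := IH n2 sg E.
  by exists sg1; split=> //; apply: ExecIfFalse => //; rewrite E.
- move=> x c s sx /andP[xn n1] sg E.
  by exists sg; split=> //; apply: ExecWhileDone; rewrite E.
- move=> x c s s1 s2 t1 t2 sx _ IH1 _ IH2 /andP[xn n1] sg E.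
  have [sg1 [e1 E1 F1]] := IH1 n1 sg E.
  have [sg2 [e2 E2 F2]] := IH2 (introT andP (conj xn n1)) sg1 E1.
  exists sg2; split=> //.
    by apply: ExecWhileStep e1 e2; rewrite E.
  by move=> y ym; rewrite F2 ?F1.
Qed.

(** Every stored tree is charged its full size, so growth is paid for by running time. *)
Lemma exec_dsize c s s' t : exec c s s' t ->
  forall M, (forall x, dsize (s x) <= M) -> forall x, dsize (s' x) <= M + t.
Proof.
elim=> {c s s' t} //.
- move=> x e s M sM y; rewrite /update; case: eqP => _; first exact: leq_addl.
  by rewrite (leq_trans (sM y)) // leq_addr.
- by move=> c1 c2 s s1 s2 t1 t2 _ IH1 _ IH2 M /IH1 /IH2 H x; rewrite addnA.
- by move=> x c1 c2 s s1 t _ _ IH M /IH H y; rewrite addnS leqW.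
- by move=> x c1 c2 s s1 t _ _ IH M /IH H y; rewrite addnS leqW.
- by move=> x c s _ M sM y; rewrite (leq_trans (sM y)) // leq_addr.
- by move=> x c s s1 s2 t1 t2 _ _ IH1 _ IH2 M /IH1 /IH2 H y; rewrite addnS leqW // addnA.
Qed.

Lemma computes_dsize c d d' t : computes c d d' t -> dsize d' <= dsize d + t.
Proof.
move=> [s e <-]; apply: exec_dsize e _ _ _ => x.
by rewrite /update; case: eqP => // _; exact: dsize_gt0.
Qed.

(** The language has no empty program, so the base case assigns as well; hence the time [n.+1]. *)
Fixpoint clear (m n : nat) : program :=
  if n is n'.+1 then Seq (clear m n') (Assign (m + n') ENil) else Assign m ENil.

Lemma exec_clear m n (sg : store) : exists sg', [/\ exec (clear m n) sg sg' n.+1,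
  forall x, x < n -> sg' (m + x) = Nil & forall y, y < m -> sg' y = sg y].
Proof.
elim: n => [|n [sg1 [e1 E1 F1]]].
  exists (update sg m Nil); split=> //; first exact: (ExecAssign m ENil).
  by move=> y ym; rewrite /update; case: eqP => // ?; lia.
exists (update sg1 (m + n) Nil); split.
- by rewrite -[n.+2]addn1; apply: ExecSeq e1 (ExecAssign _ ENil _).
- move=> x; rewrite ltnS leq_eqVlt /update eqn_add2l.
  by case: eqP => //= _ /E1.
- by move=> y ym; rewrite /update; case: eqP => [|_]; [lia | exact: F1].
Qed.

(* A subroutine call: the variables of [c] live at [m], [m + 1], ..., and must
   be cleared first, since a call inside a loop finds the leftovers of the
   previous one. *)
Definition call (n m : nat) (c : program) (r a : nat) : program :=
  Seq (clear m n) (Seq (Assign m (EVar a)) (Seq (shift m c) (Assign r (EVar m)))).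

Lemma exec_call n m c r a (sg : store) out t :
  0 < n -> vars_below n c -> a < m -> computes c (sg a) out t ->
  exists sg' t', [/\ exec (call n m c r a) sg sg' t', sg' r = out,
    forall y, y < m -> y != r -> sg' y = sg y
    & t' <= (n + dsize (sg a) + t).*2.+1].
Proof.
move=> n0 nc am cmp; have := computes_dsize cmp.
case: cmp => s e s0 out_size.
have [sg1 [e1 E1 F1]] := exec_clear m n sg.
set sg2 := update sg1 m (sg1 a).
have E2 x : x < n -> sg2 (m + x) = update (fun=> Nil) 0 (sg a) x.
  move=> xn; rewrite /sg2 /update -{2}[m]addn0 eqn_add2l F1 //.
  by case: eqP => // _; exact: E1.
have [sg3 [e3 E3 F3]] := exec_shift e nc E2.
have m_out : sg3 m = out by rewrite -s0 -E3 ?addn0.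
exists (update sg3 r (sg3 m)); eexists; split.
- apply: ExecSeq e1 (ExecSeq (ExecAssign m (EVar a) sg1) (ExecSeq e3 _)).
  exact: ExecAssign.
- by rewrite /update eqxx.
- move=> y ym /negPf yr; rewrite /update yr F3 // /sg2 /update.
  by case: eqP => [|_]; [lia | exact: F1].
(* Clearing costs [n.+1], the two copies cost the sizes of argument and result, and [out_size]
   bounds the latter by the former plus [t]. *)
- rewrite /= F1 // m_out; lia.
Qed.

End Programs.

(** * Functions computable in polynomial time *)

Section PolyTime.
Local Open Scope nat_scope.

(* [i x] encodes the input and [o x] the output for the argument [x]; the
   behaviour on data outside the range of [i] is unconstrained. *)
Definition ptime (T : Type) (i o : T -> data) : Prop :=
  exists c b, poly_bounded i b /\
    forall x, exists2 t, computes c (i x) (o x) t & t <= b x.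

Lemma ptimeI T (i o : T -> data) c b : poly_bounded i b ->
  (forall x (s : store), s 0 = i x -> exists s' t,
    [/\ exec c s s' t, s' 0 = o x & t <= b x]) -> ptime i o.
Proof.
move=> pb H; exists c, b; split=> // x.
have [s' [t [e out tb]]] := H x (update (fun=> Nil) 0 (i x)) erefl.
by exists t => //; exists s'.
Qed.

(** The interface for building larger programs: a call can be placed above all variables in use, at
    a cost independent of the placement. *)
Lemma ptime_subroutine T (i o : T -> data) : ptime i o ->
  exists (c : nat -> nat -> nat -> program) b, poly_bounded i b /\
    forall m r a x (s : store), a < m -> s a = i x -> exists s' t,
    [/\ exec (c m r a) s s' t, s' r = o x,
        forall y, y < m -> y != r -> s' y = s y & t <= b x].
Proof.
move=> [c [b [pb H]]]; have [n n0 nc] := vars_below_exists c.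
exists (fun m => call n m c),
  (fun x => n + dsize (i x) + b x + (n + dsize (i x) + b x) + 1).
have pb' : poly_bounded i (fun x => n + dsize (i x) + b x).
  apply: poly_bounded_add pb; apply: poly_bounded_add (poly_bounded_size i).
  exact: poly_bounded_const.
split.
  exact: poly_bounded_add (poly_bounded_add pb' pb') (poly_bounded_const i 1).
move=> m r a x s am sa; have [t cmp tb] := H x; rewrite -sa in cmp *.
have [s' [t' [e out fr t'b]]] := exec_call r n0 nc am cmp.
exists s', t'; split=> //; apply: leq_trans t'b _; lia.
Qed.

Lemma ptime_size T (i o : T -> data) :
  ptime i o -> poly_bounded i (fun x => dsize (o x)).
Proof.
move=> [c [b [pb H]]].
apply: poly_bounded_le (poly_bounded_add (poly_bounded_size i) pb) _ => x.
by have [t /computes_dsize ? ?] := H x; lia.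
Qed.

Lemma eq_ptime T (i o o' : T -> data) :
  ptime i o -> (forall x, o x = o' x) -> ptime i o'.
Proof.
move=> [c [b [pb H]]] E; exists c, b; split=> // x.
by have [t] := H x; rewrite E; exists t.
Qed.

Lemma ptime_reindex S T (h : S -> T) (i o : T -> data) :
  ptime i o -> ptime (i \o h) (o \o h).
Proof.
move=> [c [b [[k pb] H]]]; exists c, (b \o h); split; last by move=> x; exact: H.
by exists k => x; exact: pb.
Qed.

Lemma ptime_id T (i : T -> data) : ptime i i.
Proof.
apply: (ptimeI (c := Assign 0 (EVar 0)) (poly_bounded_size i)) => x s s0.
by do 2![eexists]; split; [exact: ExecAssign | rewrite /update eqxx | rewrite /= s0].
Qed.

Lemma ptime_nil T (i : T -> data) : ptime i (fun=> Nil).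
Proof.
apply: (ptimeI (c := Assign 0 ENil) (poly_bounded_const i 1)) => x s s0.
by do 2![eexists]; split; [exact: ExecAssign | rewrite /update eqxx | ].
Qed.

Lemma dsize_head d : dsize (dhead d) <= dsize d.
Proof. by case: d => //= a b; lia. Qed.

Lemma dsize_tail d : dsize (dtail d) <= dsize d.
Proof. by case: d => //= a b; lia. Qed.

(** By [ptime_size] the intermediate value has polynomial size, and a bound polynomial in that size
    is polynomial in the input size. *)
Lemma ptime_comp T (i m o : T -> data) : ptime i m -> ptime m o -> ptime i o.
Proof.
move=> im mo; have pm := ptime_size im.
have [c1 [b1 [pb1 H1]]] := ptime_subroutine im.
have [c2 [b2 [pb2 H2]]] := ptime_subroutine mo.
apply: (ptimeI (c := Seq (c1 1 0 0) (c2 1 0 0))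
  (poly_bounded_add pb1 (poly_bounded_trans pm pb2))) => x s s0.
have [s1 [t1 [e1 o1 _ l1]]] := H1 1 0 0 x s isT s0.
have [s2 [t2 [e2 o2 _ l2]]] := H2 1 0 0 x s1 isT o1.
by exists s2, (t1 + t2); split; [exact: ExecSeq e1 e2 | | exact: leq_add].
Qed.

Lemma ptime_head T (i o : T -> data) : ptime i o -> ptime i (fun x => dhead (o x)).
Proof.
move/ptime_comp; apply.
apply: (ptimeI (c := Assign 0 (EHead 0)) (poly_bounded_size o)) => x s s0.
by do 2![eexists]; split;
  [exact: ExecAssign | rewrite /update eqxx /= s0 | rewrite /= s0 dsize_head].
Qed.

Lemma ptime_tail T (i o : T -> data) : ptime i o -> ptime i (fun x => dtail (o x)).
Proof.
move/ptime_comp; apply.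
apply: (ptimeI (c := Assign 0 (ETail 0)) (poly_bounded_size o)) => x s s0.
by do 2![eexists]; split;
  [exact: ExecAssign | rewrite /update eqxx /= s0 | rewrite /= s0 dsize_tail].
Qed.

Lemma ptime_cons T (i f g : T -> data) :
  ptime i f -> ptime i g -> ptime i (fun x => Cons (f x) (g x)).
Proof.
move=> pf pg.
have pb := poly_bounded_add (ptime_size pf) (ptime_size pg).
have [c1 [b1 [pb1 H1]]] := ptime_subroutine pf.
have [c2 [b2 [pb2 H2]]] := ptime_subroutine pg.
(* The first result waits in variable 1 while the second call overwrites the input in variable 0. *)
apply: (ptimeI (c := Seq (c1 2 1 0) (Seq (c2 2 0 0) (Assign 0 (ECons 1 0))))
  (poly_bounded_add (poly_bounded_add pb1 pb2)
    (poly_bounded_add (poly_bounded_const i 1) pb))) => x s s0.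
have [s1 [t1 [e1 o1 f1 l1]]] := H1 2 1 0 x s isT s0.
have [s2 [t2 [e2 o2 f2 l2]]] := H2 2 0 0 x s1 isT (etrans (f1 0 isT isT) s0).
do 2![eexists]; split.
- exact: ExecSeq e1 (ExecSeq e2 (ExecAssign _ _ _)).
- by rewrite /update eqxx /= o2 f2 // o1.
- rewrite /= o2 f2 // o1; lia.
Qed.

Definition dif (b f g : data) : data := if b is Nil then g else f.

Lemma ptime_if T (i b f g : T -> data) : ptime i b ->
  ptime i f -> ptime i g -> ptime i (fun x => dif (b x) (f x) (g x)).
Proof.
move=> pb pf pg.
have [c0 [b0 [pb0 H0]]] := ptime_subroutine pb.
have [c1 [b1 [pb1 H1]]] := ptime_subroutine pf.
have [c2 [b2 [pb2 H2]]] := ptime_subroutine pg.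
apply: (ptimeI (c := Seq (c0 2 1 0) (If 1 (c1 2 0 0) (c2 2 0 0)))
  (poly_bounded_add pb0 (poly_bounded_add (poly_bounded_const i 1)
     (poly_bounded_add pb1 pb2)))) => x s s0.
have [s1 [t1 [e1 o1 f1 l1]]] := H0 2 1 0 x s isT s0.
have s10 : s1 0 = i x by rewrite f1.
case E : (b x) => [|d d'] /=; rewrite E in o1.
  have [s2 [t2 [e2 o2 _ l2]]] := H2 2 0 0 x s1 isT s10.
  by do 2![eexists]; split;
    [exact: ExecSeq e1 (ExecIfFalse _ o1 e2) | | lia].
have [s2 [t2 [e2 o2 _ l2]]] := H1 2 0 0 x s1 isT s10.
by do 2![eexists]; split;
  [apply: ExecSeq e1 (ExecIfTrue _ _ e2); rewrite o1 | | lia].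
Qed.

(** * Lists, unary numbers and loops *)

Definition dlist : seq data -> data := foldr Cons Nil.

(** Every tree is read as the list along its right spine, so loops need no well-formedness
    assumption. *)
Fixpoint dseq (d : data) : seq data := if d is Cons a b then a :: dseq b else [::].

Lemma dlistK : cancel dlist dseq.
Proof. by elim=> //= a s ->. Qed.

Lemma size_dseq d : size (dseq d) < dsize d.
Proof. by elim: d => //= a _ b; rewrite !ltnS => IH; lia. Qed.

Lemma dsize_dlist s : dsize (dlist s) = (sumn [seq (dsize a).+1 | a <- s]).+1.
Proof. by elim: s => //= a s ->; lia. Qed.

(** Variable 0 holds the environment, 1 the accumulator, 2 the rest of the list; 3 packs
    environment, accumulator and current entry as argument of [c]. *)
Definition fold_program (c : program) : program :=
  While 2 (Seq (Assign 3 (EHead 2)) (Seq (Assign 2 (ETail 2))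
    (Seq (Assign 3 (ECons 1 3)) (Seq (Assign 3 (ECons 0 3)) c)))).

(** [L] bounds the accumulators, [N] the packed argument and [M] the time of the body. Each round
    makes four assignments of size at most [N]. *)
Lemma exec_fold A (env : data) (e : A -> data) (f : A -> data -> A) c L M N
    (l : data) (a : A) (s : store) :
  (forall a d (s : store), s 3 = Cons env (Cons (e a) d) ->
    dsize (s 3) <= N ->
    exists s' t, [/\ exec c s s' t, s' 1 = e (f a d),
      forall y, y < 4 -> y != 1 -> s' y = s y & t <= M]) ->
  dsize env + L + dsize l + 2 <= N ->
  (forall k, dsize (e (foldl f a (take k (dseq l)))) <= L) ->
  s 0 = env -> s 1 = e a -> s 2 = l ->
  exists s' t, [/\ exec (fold_program c) s s' t, s' 1 = e (foldl f a (dseq l)) &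
    t <= (size (dseq l)) * (N + N + N + N + M).+1 + 1].
Proof.
move=> Hc; elim: l a s => [|d _ l IH] a s lN aL s0 s1 s2.
  by exists s, 1; split=> //; exact: ExecWhileDone.
have aL0 : dsize (e a) <= L by exact: (aL 0).
rewrite /= in lN *.
pose x1 := update s 3 (eval s (EHead 2)).
pose x2 := update x1 2 (eval x1 (ETail 2)).
pose x3 := update x2 3 (eval x2 (ECons 1 3)).
pose x4 := update x3 3 (eval x3 (ECons 0 3)).
have E3 : eval x2 (ECons 1 3) = Cons (e a) d by rewrite /= /x2 /x1 /update /= s1 s2.
have E4 : eval x3 (ECons 0 3) = Cons env (Cons (e a) d).
  by rewrite -E3 /= /x3 /x2 /x1 /update /= s0.
have [s' [t [ec o1 fr tM]]] := Hc a d x4 E4 ltac:(rewrite /x4 /update eqxx E4 /=; lia).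
have s'2 : s' 2 = l by rewrite fr // /x4 /x3 /x2 /x1 /update /= s2.
have s'0 : s' 0 = env by rewrite fr.
have [s'' [t' [e' o' t'M]]] := IH (f a d) s' ltac:(lia) (fun k => aL k.+1) s'0 o1 s'2.
do 2![eexists]; split; [|exact: o'|].
  apply: (ExecWhileStep _ _ e'); first by rewrite s2.
  by do 4![apply: ExecSeq (ExecAssign _ _ _) _]; exact: ec.
rewrite -/x1 -/x2 -/x3 -/x4 E3 E4 /= s2 /x1 /update /= s2 /=; nia.
Qed.

(** A polynomial-time body that doubles the accumulator would make it exponentially large, hence the
    bound [b] over all prefixes. Under it every round costs polynomial time, and there are fewer
    rounds than [dsize (l x)]. *)
Lemma ptime_foldl T A (i : T -> data) (e : A -> data) (f : T -> A -> data -> A)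
    (a : T -> A) (l : T -> data) (b : T -> nat) :
  ptime (fun z : T * A * data => Cons (i z.1.1) (Cons (e z.1.2) z.2))
        (fun z => e (f z.1.1 z.1.2 z.2)) ->
  ptime i (e \o a) -> ptime i l -> poly_bounded i b ->
  (forall x k, dsize (e (foldl (f x) (a x) (take k (dseq (l x))))) <= b x) ->
  ptime i (fun x => e (foldl (f x) (a x) (dseq (l x)))).
Proof.
move=> pf pa pl pb ab.
have [c1 [b1 [pb1 H1]]] := ptime_subroutine pa.
have [c2 [b2 [pb2 H2]]] := ptime_subroutine pl.
have [c3 [b3 [[k pb3] H3]]] := ptime_subroutine pf.
pose N x := dsize (i x) + b x + dsize (l x) + 2.
have pN : poly_bounded i N.
  apply: poly_bounded_add (poly_bounded_const i 2).
  apply: poly_bounded_add (ptime_size pl).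
  exact: poly_bounded_add (poly_bounded_size i) pb.
pose M x := N x + N x + N x + N x + (N x + 1) ^ k.
have pM : poly_bounded i M.
  do 4?[apply: poly_bounded_add => //]; apply: poly_bounded_exp.
  by apply: poly_bounded_add pN (poly_bounded_const i 1).
pose bound x := b1 x + (b2 x + (dsize (l x) * (M x + 1) + 1 + b x)).
apply: (ptimeI (c := Seq (c1 4 1 0) (Seq (c2 4 2 0)
  (Seq (fold_program (c3 4 1 3)) (Assign 0 (EVar 1))))) (b := bound)).
  apply: poly_bounded_add pb1 _; apply: poly_bounded_add pb2 _.
  apply: poly_bounded_add pb; apply: poly_bounded_add (poly_bounded_const i 1).
  apply: poly_bounded_mul; first exact: ptime_size pl.
  exact: poly_bounded_add pM (poly_bounded_const i 1).
move=> x s s0.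
have [s1 [t1 [e1 o1 f1 l1]]] := H1 4 1 0 x s isT s0.
have s10 : s1 0 = i x by rewrite f1.
have [s2 [t2 [e2 o2 f2 l2]]] := H2 4 2 0 x s1 isT s10.
have s20 : s2 0 = i x by rewrite f2.
have s21 : s2 1 = e (a x) by rewrite f2.
have Hc a' d (s' : store) : s' 3 = Cons (i x) (Cons (e a') d) -> dsize (s' 3) <= N x ->
    exists s'' t, [/\ exec (c3 4 1 3) s' s'' t, s'' 1 = e (f x a' d),
      forall y, y < 4 -> y != 1 -> s'' y = s' y & t <= (N x + 1) ^ k].
  move=> s'3 sN; have [s'' [t [? ? ? tb]]] := H3 4 1 3 (x, a', d) s' isT s'3.
  exists s'', t; split=> //; apply: leq_trans tb (leq_trans (pb3 _) _).
  by rewrite s'3 in sN; rewrite leq_exp2rW // addn1.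
have [s3 [t3 [e3 o3 l3]]] := exec_fold Hc (leqnn (N x)) (ab x) s20 s21 o2.
do 2![eexists]; split.
- exact: ExecSeq e1 (ExecSeq e2 (ExecSeq e3 (ExecAssign _ _ _))).
- by rewrite /update eqxx.
- have := ab x (size (dseq (l x))); rewrite take_size /= o3 => ol.
  have sl := size_dseq (l x).
  rewrite /bound /M; apply: leq_add l1 (leq_add l2 (leq_add _ ol)).
  by apply: leq_trans l3 _; rewrite leq_add2r -addn1 leq_mul2r ltnW ?orbT.
Qed.

(** As a list this has [n] entries, so it drives a loop of [n] rounds; it is also the format of
    [enc_vertex]. *)
Definition unary (n : nat) : data := iter n (Cons Nil) Nil.

Lemma dsize_unary n : dsize (unary n) = n.*2.+1.
Proof. by elim: n => //= n; rewrite -/(unary n) => ->; lia. Qed.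

Lemma size_dseq_unary n : size (dseq (unary n)) = n.
Proof. by elim: n => //= n; rewrite -/(unary n) => ->. Qed.

Lemma ptime_fst T U (i g : T -> data) (e : U -> data) :
  ptime i g -> ptime (fun z : T * U => Cons (i z.1) (e z.2)) (fun z => g z.1).
Proof.
move=> /(ptime_reindex (@fst T U)); apply: ptime_comp.
exact: ptime_head (ptime_id _).
Qed.

Lemma ptime_snd T U (i : T -> data) (e : U -> data) :
  ptime (fun z : T * U => Cons (i z.1) (e z.2)) (fun z => e z.2).
Proof. exact: ptime_tail (ptime_id _). Qed.

(** The list [u x] serves as loop counter; the accumulator only shrinks. *)
Lemma ptime_drop T (i d u : T -> data) : ptime i d -> ptime i u ->
  ptime i (fun x => iter (size (dseq (u x))) dtail (d x)).
Proof.
move=> pd pu.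
have foldE A (g : A -> A) a (s : seq data) :
  foldl (fun a _ => g a) a s = iter (size s) g a.
  by elim: s a => //= _ s IH a; rewrite IH -iterSr.
apply: eq_ptime (ptime_foldl (e := id) (f := fun _ a _ => dtail a)
  _ pd pu (ptime_size pd) _) _; last by move=> x; rewrite foldE.
- exact: ptime_tail (ptime_head (ptime_tail (ptime_id _))).
- move=> x k; rewrite foldE; elim: (size _) => //= n.
  exact/leq_trans/dsize_tail.
Qed.

Lemma ptime_nth T (i d : T -> data) (n : T -> nat) :
  ptime i d -> ptime i (unary \o n) ->
  ptime i (fun x => nth Nil (dseq (d x)) (n x)).
Proof.
move=> pd pn; apply: eq_ptime (ptime_head (ptime_drop pd pn)) _ => x /=.
rewrite size_dseq_unary; elim: (n x) (d x) => [|k IH] [|a b] //;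
  by rewrite iterSr /= IH // nth_nil.
Qed.

Lemma ptime_length T (i l : T -> data) :
  ptime i l -> ptime i (fun x => unary (size (dseq (l x)))).
Proof.
move=> pl.
have foldE n (s : seq data) : foldl (fun m _ => m.+1) n s = n + size s.
  by elim: s n => [n|_ s IH n] /=; rewrite ?addn0 // IH addSnnS.
apply: eq_ptime (ptime_foldl (e := unary) (f := fun _ m _ => m.+1) (a := fun=> 0)
  (b := fun x => dsize (l x) + dsize (l x) + 1) _ (ptime_nil i) pl _ _) _.
- apply: (@ptime_cons _ _ (fun=> Nil)); first exact: ptime_nil.
  exact: ptime_head (ptime_tail (ptime_id _)).
- apply: poly_bounded_add (poly_bounded_const i 1).
  by apply: poly_bounded_add; exact: ptime_size.
- move=> x k; rewrite foldE dsize_unary size_take_min.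
  have := size_dseq (l x); lia.
- by move=> x; rewrite foldE.
Qed.

Lemma ptime_ifb T (i f g : T -> data) (b : T -> bool) :
  ptime i (fun x => enc_bool (b x)) -> ptime i f -> ptime i g ->
  ptime i (fun x => if b x then f x else g x).
Proof.
move=> pb pf pg; apply: eq_ptime (ptime_if pb pf pg) _ => x.
by case: (b x).
Qed.

Lemma ptime_true T (i : T -> data) : ptime i (fun=> enc_bool true).
Proof. exact: ptime_cons (ptime_nil i) (ptime_nil i). Qed.

Lemma ptime_negb T (i : T -> data) (b : T -> bool) :
  ptime i (fun x => enc_bool (b x)) -> ptime i (fun x => enc_bool (~~ b x)).
Proof.
move=> pb; apply: eq_ptime (ptime_ifb pb (ptime_nil i) (ptime_true i)) _ => x.
by case: (b x).
Qed.

Lemma ptime_andb T (i : T -> data) (b c : T -> bool) :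
  ptime i (fun x => enc_bool (b x)) -> ptime i (fun x => enc_bool (c x)) ->
  ptime i (fun x => enc_bool (b x && c x)).
Proof.
move=> pb pc; apply: eq_ptime (ptime_ifb pb pc (ptime_nil i)) _ => x.
by case: (b x).
Qed.

Lemma ptime_orb T (i : T -> data) (b c : T -> bool) :
  ptime i (fun x => enc_bool (b x)) -> ptime i (fun x => enc_bool (c x)) ->
  ptime i (fun x => enc_bool (b x || c x)).
Proof.
move=> pb pc; apply: eq_ptime (ptime_ifb pb (ptime_true i) pc) _ => x.
by case: (b x).
Qed.

Definition nonnil (d : data) : bool := if d is Nil then false else true.

Lemma ptime_nonnil T (i d : T -> data) :
  ptime i d -> ptime i (fun x => enc_bool (nonnil (d x))).
Proof.
move=> pd; apply: eq_ptime (ptime_if pd (ptime_true i) (ptime_nil i)) _ => x.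
by case: (d x).
Qed.

Lemma nonnil_enc_bool b : nonnil (enc_bool b) = b.
Proof. by case: b. Qed.

Lemma nonnil_unary n : nonnil (unary n) = (0 < n).
Proof. by case: n. Qed.

(** Dropping [m] cells from [unary n] leaves something exactly when [m < n]. *)
Lemma ptime_ltn T (i : T -> data) (m n : T -> nat) :
  ptime i (unary \o m) -> ptime i (unary \o n) ->
  ptime i (fun x => enc_bool (m x < n x)).
Proof.
move=> pm pn; apply: eq_ptime (ptime_nonnil (ptime_drop pn pm)) _ => x /=.
rewrite size_dseq_unary -subn_gt0 -nonnil_unary; congr (enc_bool (nonnil _)).
elim: (m x) (n x) => [|k IH] j; first by rewrite subn0.
by rewrite iterSr; case: j => [|j]; [exact: (IH 0) | exact: (IH j)].
Qed.

Lemma ptime_eqn T (i : T -> data) (m n : T -> nat) :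
  ptime i (unary \o m) -> ptime i (unary \o n) ->
  ptime i (fun x => enc_bool (m x == n x)).
Proof.
move=> pm pn; apply: eq_ptime (ptime_andb (ptime_negb (ptime_ltn pm pn))
  (ptime_negb (ptime_ltn pn pm))) _ => x.
by rewrite -!leqNgt eqn_leq andbC.
Qed.

(** The accumulator pairs an index, counting down from [n x], with the part of the list already
    built; prepending while counting down yields the right order. *)
Lemma ptime_mkseq T (i : T -> data) (n : T -> nat) (g : T -> nat -> data) :
  ptime i (unary \o n) ->
  ptime (fun z : T * nat => Cons (i z.1) (unary z.2)) (fun z => g z.1 z.2) ->
  ptime i (fun x => dlist (mkseq (g x) (n x))).
Proof.
move=> pn pg.
pose e (z : nat * seq data) := Cons (unary z.1) (dlist z.2).
pose f x (z : nat * seq data) (_ : data) := (z.1.-1, g x z.1.-1 :: z.2).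
have foldE x s : size s <= n x -> foldl (f x) (n x, [::]) s =
    (n x - size s, [seq g x j | j <- iota (n x - size s) (size s)]).
  elim/last_ind: s => [|s d IH]; first by rewrite subn0.
  rewrite size_rcons -cats1 foldl_cat => sn; rewrite IH ?(ltnW sn) //= /f /=.
  by rewrite -subnS subnSK.
have [K pK] := ptime_size pg.
pose L x := dsize (unary (n x)).
have pL : poly_bounded i L by exact: ptime_size pn.
(* Bounds each entry [g x j] with [j < n x], computed from the pair of [i x] and [unary j]. *)
pose G x := (dsize (i x) + L x + 2) ^ K.
have pG : poly_bounded i G.
  apply: poly_bounded_exp; apply: poly_bounded_add (poly_bounded_const i 2).
  exact: poly_bounded_add (poly_bounded_size i) pL.
have gG x j : j < n x -> dsize (g x j) <= G x.
  move=> jn; apply: leq_trans (pK (x, j)) _; rewrite leq_exp2rW //= /L !dsize_unary.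
  lia.
apply: eq_ptime (ptime_tail (ptime_foldl (e := e) (f := f) (l := unary \o n)
  (a := fun x => (n x, [::])) (b := fun x => L x + (L x * (G x + 1) + 2))
  _ _ pn _ _)) _; rewrite /e /f /=.
- have pc : ptime (fun z : T * (nat * seq data) * data =>
      Cons (i z.1.1) (Cons (e z.1.2) z.2)) (fun z => unary z.1.2.1.-1).
    apply: eq_ptime (ptime_tail (ptime_head (ptime_head (ptime_tail (ptime_id _))))) _.
    by move=> [[x [[|m] s]] d].
  apply: (ptime_cons pc); apply: ptime_cons; last first.
    exact: ptime_tail (ptime_head (ptime_tail (ptime_id _))).
  have := ptime_reindex (fun z : T * (nat * seq data) * data => (z.1.1, z.1.2.1.-1)) pg.
  by apply: ptime_comp; apply: (ptime_cons _ pc); exact: ptime_head (ptime_id _).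
- exact: ptime_cons pn (ptime_nil i).
- apply: (poly_bounded_add pL); apply: poly_bounded_add (poly_bounded_const i 2).
  exact: poly_bounded_mul pL (poly_bounded_add pG (poly_bounded_const i 1)).
- move=> x k; set s := take k _.
  have sn : size s <= n x by rewrite size_take_min size_dseq_unary; lia.
  rewrite foldE //= dsize_dlist addnS -addSn !dsize_unary.
  have -> : L x = (n x).*2.+1 by rewrite /L dsize_unary.
  have : sumn [seq (dsize a).+1 | a <- [seq g x j | j <- iota (n x - size s) (size s)]]
     <= size s * (G x + 1).
    rewrite -map_comp -[X in _ <= X * _](size_iota (n x - size s)).
    have : {in iota (n x - size s) (size s), forall j, j < n x}.
      by move=> j; rewrite mem_iota; lia.
    elim: (iota _ _) => //= j r IH jn; rewrite mulSn leq_add //.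
      by rewrite addn1 ltnS gG // jn // mem_head.
    by apply: IH => j' j'r; rewrite jn // inE j'r orbT.
  nia.
- by move=> x; rewrite foldE size_dseq_unary // subnn.
Qed.

(** With [Nil] encoding [None], this searches for the first [Some]. *)
Definition first (s : seq data) : data := head Nil (filter nonnil s).

(** Once different from [Nil] the accumulator never changes; being [Nil] or an entry, it stays
    small. *)
Lemma ptime_first T (i : T -> data) (s : T -> seq data) :
  ptime i (fun x => dlist (s x)) -> ptime i (fun x => first (s x)).
Proof.
move=> ps; pose f (a d : data) := dif a a d.
apply: eq_ptime (ptime_foldl (e := id) (f := fun _ => f) (a := fun=> Nil)
  (b := fun x => 1 + dsize (dlist (s x))) _ (ptime_nil i) ps _ _) _.
- have pa : ptime (fun z : T * data * data => Cons (i z.1.1) (Cons z.1.2 z.2))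
      (fun z => z.1.2) by exact: ptime_head (ptime_tail (ptime_id _)).
  exact: (ptime_if pa pa (ptime_tail (ptime_tail (ptime_id _)))).
- exact: poly_bounded_add (poly_bounded_const i 1) (ptime_size ps).
- move=> x k; rewrite dlistK dsize_dlist -[1]/(dsize Nil).
  elim: (s x) k Nil => [|d r IH] [|k] a //=; try lia.
  by apply: leq_trans (IH k _) _; case: a => /=; lia.
- move=> x; rewrite dlistK /first.
  elim: (s x) => //= -[|a b] r IH //=; rewrite {IH}.
  by elim: r => //= d r ->.
Qed.

End PolyTime.

(** * The combined solution *)

Section Leaves.
Variables (n : nat) (W : {set 'I_n}) (E : {set 'I_n * 'I_n}) (att : rel 'I_n).

(** In [att x y] the leaf is [x]. Edges are recorded as increasing pairs, so the leaf may be either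
    component. *)
Definition add_leaves : {set 'I_n * 'I_n} :=
  [set e | (e \in E) || (e.1 < e.2)%N && (att e.1 e.2 || att e.2 e.1)].

Hypothesis treeWE : is_tree W E.
Hypothesis attW : forall x y, att x y -> x \notin W /\ y \in W.
Hypothesis att_fun : forall x y z, att x y -> att x z -> y = z.

Let adjE x y : adjacent add_leaves x y = [|| adjacent E x y, att x y | att y x].
Proof.
have [edgeW _ _] := treeWE.
rewrite /adjacent !inE /=; case: (ltngtP x y) => [xy|yx|/ord_inj xy] /=.
- by rewrite orbF orbAC.
- by rewrite orbF [att y x || _]orbC orbA.
- rewrite xy !orbF; suff /negPf -> : ~~ att y y by rewrite !orbF.
  by apply/negP => /attW[/negP].
Qed.

(** Each new vertex has a neighbour in [W], which gives connectedness. It has only one neighbour, so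
    no cycle of length at least three passes through it. *)
Lemma is_tree_add_leaves :
  is_tree (W :|: [set x | [exists y, att x y]]) add_leaves.
Proof.
have [edgeW conW acyc] := treeWE.
have adjW x y : adjacent E x y -> (x \in W) && (y \in W).
  by case/orP => /edgeW[_ -> ->].
split.
- move=> x y; rewrite !inE /= => /orP[/edgeW[-> -> ->] //|/andP[-> axy]].
  by split=> //; case/orP: axy => a; have [_ zW] := attW a; rewrite ?zW //;
    apply/orP; right; apply/existsP; eexists; exact: a.
- have sym : connect_sym (adjacent add_leaves).
    by apply: sym_connect_sym => x y; rewrite /adjacent orbC.
  have toW x : x \in W :|: [set x | [exists y, att x y]] ->
      exists2 w, w \in W & connect (adjacent add_leaves) x w.
    rewrite !inE; case: (boolP (x \in W)) => [xW _|_ /= /existsP[y axy]].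
      by exists x.
    exists y; first by have [] := attW axy.
    by apply: connect1; rewrite adjE axy orbT.
  move=> x y /toW[v vW xv] /toW[w wW yw].
  apply: connect_trans xv _; rewrite sym; apply: connect_trans yw _.
  apply: connect_sub (conW _ _ wW vW) => a b ab; apply: connect1.
  by rewrite adjE ab.
- move=> s cyc; rewrite leqNgt; apply/negP => s_gt2.
  case: (boolP (all (mem W) s)) => [/allP sW|/allPn[x xs xW]].
    (* New edges have an end outside [W], so a cycle within [W] is one of the old tree. *)
    suff /acyc : ucycle (adjacent E) s by rewrite leqNgt s_gt2.
    case/andP: cyc => cyc us; rewrite /ucycle us andbT.
    case: s sW cyc {s_gt2 us} => //= x s sW.
    have : all (mem W) (x :: rcons s x).
      by apply/allP => y; rewrite -rcons_cons mem_rcons inE => /orP[/eqP->|/sW //];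
        apply: sW; rewrite mem_head.
    move: (rcons s x) => r; elim: r x {sW} => //= y r IH z /andP[zW yrW] /andP[zy yr].
    rewrite (IH y) // andbT; move: zy; rewrite adjE => /or3P[// | /attW[] | /attW[]].
      by rewrite [z \in W]zW.
    by case/andP: yrW => yW _; rewrite [y \in W]yW.
  have {}xW : x \notin W by [].
  (* Rotated to start at the leaf [x], the cycle has the unique neighbour of [x] both as its second
     and as its last vertex, although its vertices are distinct. *)
  have [k r rotE] := rot_to xs.
  rewrite -(rot_ucycle k) rotE in cyc; rewrite -(size_rot k) rotE in s_gt2.
  have adjx y : adjacent add_leaves x y -> att x y.
    rewrite adjE => /or3P[/adjW/andP[xW' _] | // | /attW[_ xW']];
    by rewrite xW' in xW.
  have adjxC y : adjacent add_leaves y x -> att x y.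
    by move=> h; apply: adjx; rewrite /adjacent orbC.
  case: r s_gt2 cyc {rotE} => [|a r] //; case/lastP: r => [|r b] // _.
  rewrite /ucycle /= rcons_path last_rcons => /andP[/and3P[xa _ bx]].
  rewrite (att_fun (adjx _ xa) (adjxC _ bx)) mem_rcons mem_head.
  by rewrite andbF.
Qed.

End Leaves.

(** * Feasibility and cost of the combination *)

Section Combine.
Variables (I : instance) (S1 S2 : solution (nV I)).
Implicit Types i j x y : 'I_(nV I).

Definition combined_assign : {ffun 'I_(nV I) -> option 'I_(nV I)} :=
  [ffun j => if assign S1 j is Some _ then assign S2 j else None].

(* The vertex of the tree of [S1] to which facility [i] may be linked: the
   facility serving in [S1] some client of [i]. *)
Definition anchor i : option 'I_(nV I) :=
  obind (assign S1) (ohead [seq j <- enum 'I_(nV I) | combined_assign j == Some i]).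

Definition attached x y : bool :=
  (x \notin tree_vertices S1) && (anchor x == Some y).

(** A facility has an anchor exactly when it serves a client in the combined assignment, so [anchor]
    doubles as the test for being open. *)
Definition combined : solution (nV I) :=
  Solution [set i | anchor i] combined_assign
    (tree_vertices S1 :|: [set i | anchor i])
    (add_leaves (tree_edges S1) attached).

Lemma combined_assignP j i : combined_assign j = Some i ->
  exists2 y, assign S1 j = Some y & assign S2 j = Some i.
Proof. by rewrite ffunE; case: (assign S1 j) => // y; exists y. Qed.

Lemma anchorP i y : anchor i = Some y -> exists2 j,
  combined_assign j = Some i & assign S1 j = Some y.
Proof.
rewrite /anchor; case E : (filter _ _) => [|j s] //= jy; exists j => //.
by have := mem_head j s; rewrite -E mem_filter => /andP[/eqP].
Qed.

(** The client found by the search need not be [j], but every client served in the combination is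
    served in [S1] too. *)
Lemma anchor_assign j i : combined_assign j = Some i -> anchor i.
Proof.
move=> ji; rewrite /anchor; case E : (filter _ _) => [|k s] /=.
  have : j \in [seq k <- enum 'I_(nV I) | combined_assign k == Some i].
    by rewrite mem_filter ji eqxx mem_enum.
  by rewrite E.
have := mem_head k s; rewrite -E mem_filter => /andP[/eqP/combined_assignP[y ->]].
by [].
Qed.

Section Feasible.
Variables (R : realType) (X : variant) (gcap gcard : R).
Hypothesis feas1 : feasible ConPFL S1 (1 : R) 1.
Hypothesis feas2 : feasible (CP X) S2 gcap gcard.

Lemma combined_opened : opened combined \subset opened S2.
Proof.
have [_ asg _ _ _] := feas2.
apply/subsetP => i; rewrite inE; case E : (anchor i) => [y|] // _.
by have [j /combined_assignP[_ _ /asg[]]] := anchorP E.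
Qed.

(** Compared with [S2], facilities are only closed and clients only dropped, so capacity and
    cardinality bounds carry over with their factors. *)
Lemma combined_feasible : feasible (ConCP X) combined gcap gcard.
Proof.
have [op1 asg1 _ _ /(_ isT)[opW tree1]] := feas1.
have [op2 asg2 /(_ isT) cap2 card2 _] := feas2.
have attW x y : attached x y -> x \notin tree_vertices S1 /\ y \in tree_vertices S1.
  move=> /andP[xW /eqP/anchorP[j _ /asg1[_ yO]]]; split=> //.
  exact: (subsetP opW).
have att_fun x y z : attached x y -> attached x z -> y = z.
  by move=> /andP[_ /eqP E] /andP[_]; rewrite E => /eqP[].
split=> /=.
- exact: subset_trans combined_opened op2.
- move=> j i ji; have [y _ /asg2[jC _]] := combined_assignP ji.
  by split=> //; rewrite inE (anchor_assign ji).
- move=> _ i iO; apply: le_trans (cap2 i (subsetP combined_opened _ iO)).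
  rewrite ler_nat; apply/subset_leq_card/subsetP => j; rewrite !inE.
  by move=> /eqP/combined_assignP[y _ ->].
- move=> bX; apply: le_trans (card2 bX).
  by rewrite ler_nat; apply/subset_leq_card/combined_opened.
- move=> _; split; first exact: subsetUr.
  (* Open facilities already in the tree need no link, so the vertices added are exactly the
     attached ones. *)
  have -> : tree_vertices S1 :|: [set i | anchor i] =
      tree_vertices S1 :|: [set x | [exists y, attached x y]].
    apply/setP => x; rewrite !inE; case: (boolP (x \in _)) => //= xW.
    apply/idP/existsP => [|[y /andP[_ /eqP ->]] //].
    by case E : (anchor x) => [y|] // _; exists y; rewrite /attached xW E /=.
  exact: is_tree_add_leaves.
Qed.

End Feasible.

Definition connection_cost (S : solution (nV I)) j : rat :=
  if assign S j is Some i then dist j i else 0.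

Section Cost.
Variables (R : realType) (X : variant) (gcap gcard : R).
Hypothesis feas1 : feasible ConPFL S1 (1 : R) 1.
Hypothesis feas2 : feasible (CP X) S2 gcap gcard.
Hypothesis validI : valid (ConCP X) I.

Let dist_ge0 x y : 0 <= dist x y.
Proof. by have [[]] := validI. Qed.

Let distC x y : dist x y = dist y x.
Proof. by have [[]] := validI. Qed.

Let conn_ge0 S j : 0 <= connection_cost S j.
Proof. by rewrite /connection_cost; case: (assign S j). Qed.

(** The link of [x] is bounded by [h x j] for one client [j] of [x], hence by the sum over all
    clients of [x]. After exchanging the sums, each client contributes for its own facility only. *)
Lemma leaf_cost_le :
  \sum_x \sum_(y | attached x y) dist x y <=
  \sum_(j in clients I) (connection_cost S1 j + connection_cost S2 j).
Proof.
have [_ asg1 _ _ _] := feas1.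
have [[_ _ _ tri] _ _ _] := validI.
pose h x j := connection_cost S1 j + dist j x.
have h_ge0 x j : 0 <= h x j by rewrite addr_ge0.
apply: (@le_trans _ _ (\sum_x \sum_(j | combined_assign j == Some x) h x j)).
  apply: ler_sum => x _; case E : (anchor x) => [y|]; last first.
    by rewrite big_pred0 ?sumr_ge0 // => y; rewrite /attached E andbF.
  have [j jx jy] := anchorP E.
  apply: (@le_trans _ _ (dist x y)).
    rewrite (bigID (pred1 y)) /= [X in _ + X]big1 ?addr0; last first.
      by move=> z /andP[/andP[_]]; rewrite E => /eqP[->]; rewrite eqxx.
    rewrite big_mkcondl big_pred1_eq; case: ifP => _ //; exact: dist_ge0.
  rewrite (bigD1 j) ?jx //= -[leLHS]addr0 lerD ?sumr_ge0 //.
  by rewrite /h /connection_cost jy addrC (distC j x) tri.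
rewrite (exchange_big_dep xpredT) //= [leRHS]big_mkcond; apply: ler_sum => j _.
case E : (combined_assign j) => [x|]; last first.
  by rewrite big_pred0 //; case: ifP => // _; rewrite addr_ge0.
have [y jy jx] := combined_assignP E.
rewrite (asg1 _ _ jy).1 (big_pred1 x) => [|z]; last by rewrite /= eq_sym.
by rewrite /h {3}/connection_cost jx.
Qed.

(** Edges split into old and new ones. The new ones form two groups, according to which component is
    the leaf, and together they are bounded by the sum over links. *)
Lemma combined_tree_cost_le :
  \sum_(e in tree_edges combined) dist e.1 e.2 <=
  \sum_(e in tree_edges S1) dist e.1 e.2
  + \sum_(j in clients I) (connection_cost S1 j + connection_cost S2 j).
Proof.
rewrite [leLHS](bigID (mem (tree_edges S1))) /=; apply: lerD.
  rewrite (eq_bigl (mem (tree_edges S1))) // => e; rewrite !inE.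
  by case: (e \in tree_edges S1); rewrite ?andbF.
apply: le_trans leaf_cost_le.
rewrite pair_big_dep /=.
pose lt (e : 'I_(nV I) * 'I_(nV I)) := (e.1 < e.2)%N.
pose att (e : 'I_(nV I) * 'I_(nV I)) := attached e.1 e.2.
pose swap (e : 'I_(nV I) * 'I_(nV I)) := (e.2, e.1).
have d_ge0 (e : 'I_(nV I) * 'I_(nV I)) : 0 <= dist e.1 e.2 by [].
apply: (@le_trans _ _ (\sum_(e | lt e && att e) dist e.1 e.2 +
                       \sum_(e | lt e && att (swap e)) dist e.1 e.2)).
  rewrite big_mkcond [X in _ <= X + _]big_mkcond [X in _ <= _ + X]big_mkcond.
  rewrite -big_split /=; apply: ler_sum => e _; rewrite !inE /lt /att /=.
  by case: (e \in _); case: (_ < _)%N; case: (attached _ _);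
     case: (attached _ _); rewrite /= ?addr0 ?add0r ?addr_ge0 // lerDl.
(* Swapping puts the leaf first in the second group too; the groups then match the increasing and
   the remaining pairs of the right-hand side. *)
rewrite [X in _ + X](reindex_inj (h := swap)) /=; last by move=> [a b] [c d] [-> ->].
rewrite [leRHS](bigID lt) /=; apply: lerD.
  by rewrite (eq_bigl (fun e => att e && lt e)) // => e; rewrite andbC.
rewrite big_mkcond [leRHS]big_mkcond; apply: ler_sum => -[x y] _.
rewrite /lt /att /swap /= distC.
by case: ltngtP => //= _; rewrite ?andbT //; case: ifP.
Qed.

(** Opening costs come from [S2], penalties from both solutions, and the tree adds the tree of [S1]
    and the connection costs of both. Only the connection costs of [S2] are counted twice; the
    surplus terms on the right are nonnegative. *)
Lemma combined_cost_le :
  cost (ConCP X) combined <= cost ConPFL S1 + 2%:R * cost (CP X) S2.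
Proof.
have [_ f_ge0 p_ge0 _] := validI.
have [op1 _ _ _ _] := feas1.
have [op2 _ _ _ _] := feas2.
have := combined_tree_cost_le; rewrite big_split /=.
have open_le : \sum_(i in opened combined) open_cost i <=
    \sum_(i in opened S2) open_cost i.
  rewrite [leRHS](big_setID (opened combined)) /= (setIidPr (combined_opened feas2)).
  by rewrite lerDl sumr_ge0 // => i; rewrite inE => /andP[_ /(subsetP op2)/f_ge0].
have conn_le : \sum_(j in clients I) connection_cost combined j <=
    \sum_(j in clients I) connection_cost S2 j.
  apply: ler_sum => j _; rewrite /connection_cost /= ffunE.
  by case: (assign S1 j) => [_|]; case: (assign S2 j).
have pay_le : \sum_(j in paying combined) penalty j <=
    \sum_(j in paying S1) penalty j + \sum_(j in paying S2) penalty j.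
  rewrite big_mkcond [X in _ <= X + _]big_mkcond [X in _ <= _ + X]big_mkcond.
  rewrite -big_split; apply: ler_sum => j _; rewrite !inE ffunE.
  case: (boolP (j \in clients I)) => [/p_ge0 pj|_] /=; last by rewrite addr0.
  by case: (assign S1 j) => [y|]; case: (assign S2 j) => [z|];
     rewrite /= ?addr0 ?add0r ?addr_ge0 // lerDl.
have open1 : 0 <= \sum_(i in opened S1) open_cost i.
  by apply: sumr_ge0 => i /(subsetP op1)/f_ge0.
have open2 : 0 <= \sum_(i in opened S2) open_cost i.
  by apply: sumr_ge0 => i /(subsetP op2)/f_ge0.
have pay2 : 0 <= \sum_(j in paying S2) penalty j.
  by apply: sumr_ge0 => j; rewrite inE => /andP[/p_ge0].
move: open_le conn_le pay_le open1 open2 pay2.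
rewrite /cost /connection_cost /=; lra.
Qed.

End Cost.
End Combine.

(** * Transfer of the approximation guarantees *)

Lemma approx_ratio_ge0 (R : realType) P (beta gcap gcard : R) :
  poly_time_approx P beta gcap gcard -> 0 <= beta.
Proof.
(* A single client without facility has to pay its penalty. *)
pose I := @Instance 1 (fun _ _ => 0) set0 (fun=> 0) setT (fun=> 1) (fun=> 0%N) 0.
(* All feasible solutions cost 1, under any relaxation, so the guarantee reads [1 <= beta]. *)
have costI gcap' gcard' (S : solution (nV I)) :
    feasible P S (gcap' : R) gcard' -> cost P S = 1.
  move=> [/= opn asg _ _ _]; move: opn; rewrite subset0 => /eqP opn.
  have noasg j : assign S j = None.
    by case E : (assign S j) => [k|] //; have [_] := asg _ _ E; rewrite opn inE.
  rewrite /cost opn big_set0 add0r big1 ?add0r; last by move=> j _; rewrite noasg.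
  rewrite (eq_bigl xpredT) => [|j]; last by rewrite !inE noasg.
  rewrite big_ord_recl big_ord0 addr0; case: ifP => _; last by rewrite addr0.
  by rewrite big1 ?addr0.
have validI : valid P I.
  by split=> //; split=> // x y; rewrite !ord1.
move=> [c [p /(_ I validI)[S [t [_ _ feasS /= le_opt]]]]].
have [Sopt optS] := exists_optimal R P I.
have := le_opt Sopt optS; rewrite (costI _ _ _ feasS) (costI _ _ _ optS.1).
by rewrite rmorph1 mulr1; apply: le_trans.
Qed.

(** [Sopt] is feasible for both relaxed problems, at the same cost for ConPFL and without the
    nonnegative tree cost for CP[X]. Nonnegative ratios allow scaling these comparisons of
    optima. *)
Lemma combined_approx (R : realType) X (I : instance) (S1 S2 Sopt : solution (nV I))
    (alpha beta gcap gcard : R) :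
  0 <= alpha -> 0 <= beta -> valid (ConCP X) I ->
  feasible ConPFL S1 (1 : R) 1 -> feasible (CP X) S2 gcap gcard ->
  (forall S : solution (nV I), optimal R ConPFL S ->
    ratr (cost ConPFL S1) <= alpha * ratr (cost ConPFL S)) ->
  (forall S : solution (nV I), optimal R (CP X) S ->
    ratr (cost (CP X) S2) <= beta * ratr (cost (CP X) S)) ->
  optimal R (ConCP X) Sopt ->
  ratr (cost (ConCP X) (combined S1 S2)) <=
    (alpha + 2%:R * beta) * ratr (cost (ConCP X) Sopt).
Proof.
move=> a_ge0 b_ge0 validI feas1 feas2 apx1 apx2 [[opn asg cap card tree] _].
have [O1 [fO1 opt1]] := exists_optimal R ConPFL I.
have [O2 [fO2 opt2]] := exists_optimal R (CP X) I.
have le1 : cost ConPFL O1 <= cost (ConCP X) Sopt by apply: opt1; split.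
have le2 : cost (CP X) O2 <= cost (ConCP X) Sopt.
  apply: le_trans (opt2 Sopt _) _; first by split.
  rewrite /cost /= addr0 lerDl sumr_ge0 // => e _.
  by have [[->]] := validI.
have ratrE (a b : rat) : ratr (a + 2%:R * b) = ratr a + 2%:R * ratr b :> R.
  by rewrite rmorphD rmorphM /= ratr_nat.
have := combined_cost_le feas1 feas2 validI; rewrite -(ler_rat R) ratrE.
move=> /le_trans; apply.
rewrite [leRHS]mulrDl -[2%:R * beta * _]mulrA; apply: lerD;
  last rewrite ler_pM2l ?ltr0n //.
  by apply: le_trans (apx1 O1 (conj fO1 opt1)) _; rewrite ler_wpM2l ?ler_rat.
by apply: le_trans (apx2 O2 (conj fO2 opt2)) _; rewrite ler_wpM2l ?ler_rat.
Qed.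

(** * Computing the combined solution *)

Lemma ptime_subst T U (i : T -> data) (e : U -> data) (g : T -> nat -> data)
    (h : U -> T) (k : U -> nat) :
  ptime (fun z : T * nat => Cons (i z.1) (unary z.2)) (fun z => g z.1 z.2) ->
  ptime e (i \o h) -> ptime e (unary \o k) -> ptime e (fun u => g (h u) (k u)).
Proof.
move=> /(ptime_reindex (fun u : U => (h u, k u))) pg ph pk.
exact: ptime_comp (ptime_cons ph pk) pg.
Qed.

Lemma enc_funE n (e : 'I_n -> data) (g : nat -> data) :
  (forall i, e i = g i) -> enc_fun e = dlist (mkseq g n).
Proof.
move=> eg; rewrite /enc_fun /mkseq -val_enum_ord -map_comp.
by congr dlist; apply: eq_map.
Qed.

Lemma size_enc_fun n (e : 'I_n -> data) : size (dseq (enc_fun e)) = n.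
Proof. by rewrite /enc_fun dlistK size_map size_enum_ord. Qed.

Lemma nth_enc_fun n (e : 'I_n -> data) (i : 'I_n) : nth Nil (dseq (enc_fun e)) i = e i.
Proof.
by rewrite /enc_fun dlistK (nth_map i) ?size_enum_ord // nth_ord_enum.
Qed.

Section Computation.
Variables (T : Type) (I : T -> instance) (X : variant).
Variables (S1 S2 : forall x, solution (nV (I x))) (i : T -> data).

Let d1 x := enc_solution ConPFL (S1 x).
Let d2 x := enc_solution (CP X) (S2 x).
Hypothesis pd1 : ptime i d1.
Hypothesis pd2 : ptime i d2.

(** From here on the combination is redone on encodings, with natural numbers as indices; the lemmas
    with suffix [E] identify the two versions. *)
Let n x := nV (I x).
Let assign1 x := nth Nil (dseq (dhead (dtail (d1 x)))).
Let assign2 x := nth Nil (dseq (dhead (dtail (d2 x)))).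
Let tree1 x := nth Nil (dseq (dhead (dtail (dtail (d1 x))))).
Let edges1 x a := nth Nil (dseq (nth Nil (dseq (dtail (dtail (dtail (d1 x))))) a)).
Let assign12 x j := if nonnil (assign1 x j) then assign2 x j else Nil.
(** The length of the tail decodes a vertex name. The test against [Nil] is needed because [None]
    would decode to vertex 0. *)
Let served x k j :=
  nonnil (assign12 x j) && (size (dseq (dtail (assign12 x j))) == k).
Let anchor12 x k :=
  first (mkseq (fun j => if served x k j then assign1 x j else Nil) (n x)).
Let attached12 x a b := ~~ nonnil (tree1 x a) &&
  (nonnil (anchor12 x a) && (size (dseq (dtail (anchor12 x a))) == b)).
Let edge12 x a b :=
  nonnil (edges1 x a b) || (a < b)%N && (attached12 x a b || attached12 x b a).

(** Environments of loop bodies: the input with one index, or with two for nested loops. *)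
Let in1 (z : T * nat) := Cons (i z.1) (unary z.2).
Let in2 (z : T * nat * nat) := Cons (in1 z.1) (unary z.2).

(** Read off as the length of the membership table of open facilities. *)
Let p_n : ptime i (unary \o n).
Proof.
apply: eq_ptime (ptime_length (ptime_head pd1)) _ => x.
by rewrite /= size_enc_fun.
Qed.

Let p_nth (d : T -> data) : ptime i d ->
  ptime in1 (fun z => nth Nil (dseq (d z.1)) z.2).
Proof. by move=> pd; apply: ptime_nth (ptime_snd _ _); exact: ptime_fst. Qed.

Let p_assign1 : ptime in1 (fun z => assign1 z.1 z.2).
Proof. exact: p_nth (ptime_head (ptime_tail pd1)). Qed.

Let p_tree1 : ptime in1 (fun z => tree1 z.1 z.2).
Proof. exact: p_nth (ptime_head (ptime_tail (ptime_tail pd1))). Qed.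

Let p_assign12 : ptime in1 (fun z => assign12 z.1 z.2).
Proof.
apply: ptime_ifb (ptime_nonnil p_assign1) _ (ptime_nil _).
exact: p_nth (ptime_head (ptime_tail pd2)).
Qed.

Let p2_fst (g : T -> nat -> data) : ptime in1 (fun z => g z.1 z.2) ->
  ptime in2 (fun z => g z.1.1 z.1.2).
Proof. exact: ptime_fst. Qed.

(** The outer index has to be skipped, so the environment is rebuilt by [ptime_subst]. *)
Let p2_snd (g : T -> nat -> data) : ptime in1 (fun z => g z.1 z.2) ->
  ptime in2 (fun z => g z.1.1 z.2).
Proof.
move=> pg; apply: (ptime_subst (h := fun z => z.1.1) (k := snd) pg).
  exact: ptime_fst (ptime_head (ptime_id in1)).
exact: (ptime_snd in1 unary).
Qed.

Let p2_fst_nat : ptime in2 (unary \o (fun z => z.1.2)).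
Proof. exact: ptime_fst (ptime_snd i unary). Qed.

Let p2_snd_nat : ptime in2 (unary \o snd).
Proof. exact: (ptime_snd in1 unary). Qed.

Let p_mkseq2 (g : T -> nat -> nat -> data) : ptime in2 (fun z => g z.1.1 z.1.2 z.2) ->
  ptime in1 (fun z => dlist (mkseq (g z.1 z.2) (n z.1))).
Proof.
move=> pg.
apply: (ptime_mkseq (i := in1) (n := n \o fst) (g := fun z => g z.1 z.2)) => //.
exact: (ptime_fst _ p_n).
Qed.

Let p_anchor12 : ptime in1 (fun z => anchor12 z.1 z.2).
Proof.
apply: ptime_first.
apply: (p_mkseq2
  (g := fun x k j => if served x k j then assign1 x j else Nil)).
apply: ptime_ifb _ (p2_snd p_assign1) (ptime_nil _).
apply: ptime_andb (ptime_nonnil (p2_snd p_assign12)) _.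
apply: ptime_eqn p2_fst_nat.
exact: ptime_length (ptime_tail (p2_snd p_assign12)).
Qed.

Let p_attached12 : ptime in2 (fun z => enc_bool (attached12 z.1.1 z.1.2 z.2)).
Proof.
apply: ptime_andb (ptime_negb (ptime_nonnil (p2_fst p_tree1))) _.
apply: ptime_andb (ptime_nonnil (p2_fst p_anchor12)) _.
apply: ptime_eqn p2_snd_nat.
exact: ptime_length (ptime_tail (p2_fst p_anchor12)).
Qed.

Let p_attached12C : ptime in2 (fun z => enc_bool (attached12 z.1.1 z.2 z.1.2)).
Proof.
apply: ptime_andb (ptime_negb (ptime_nonnil (p2_snd p_tree1))) _.
apply: ptime_andb (ptime_nonnil (p2_snd p_anchor12)) _.
apply: ptime_eqn p2_fst_nat.
exact: ptime_length (ptime_tail (p2_snd p_anchor12)).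
Qed.

Let p_edge12 : ptime in2 (fun z => enc_bool (edge12 z.1.1 z.1.2 z.2)).
Proof.
apply: ptime_orb.
  apply: ptime_nonnil; apply: ptime_nth p2_snd_nat.
  apply: (p2_fst (g := fun x => nth Nil (dseq (dtail (dtail (dtail (d1 x))))))).
  exact: p_nth (ptime_tail (ptime_tail (ptime_tail pd1))).
apply: ptime_andb (ptime_ltn p2_fst_nat p2_snd_nat) _.
exact: ptime_orb p_attached12 p_attached12C.
Qed.

Let assign1E x (j : 'I_(n x)) :
  assign1 x j = enc_option (@enc_vertex _) (assign (S1 x) j).
Proof. exact: nth_enc_fun. Qed.

Let assign2E x (j : 'I_(n x)) :
  assign2 x j = enc_option (@enc_vertex _) (assign (S2 x) j).
Proof. exact: nth_enc_fun. Qed.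

Let tree1E x (j : 'I_(n x)) : nonnil (tree1 x j) = (j \in tree_vertices (S1 x)).
Proof. by rewrite /tree1 /= nth_enc_fun nonnil_enc_bool. Qed.

Let edges1E x (a b : 'I_(n x)) :
  nonnil (edges1 x a b) = ((a, b) \in tree_edges (S1 x)).
Proof. by rewrite /edges1 /= !nth_enc_fun nonnil_enc_bool. Qed.

Let nonnil_option m (o : option 'I_m) :
  nonnil (enc_option (@enc_vertex m) o) = o.
Proof. by case: o. Qed.

Let eq_option m (o : option 'I_m) (k : 'I_m) :
  o && (size (dseq (dtail (enc_option (@enc_vertex m) o))) == k) = (o == Some k).
Proof. by case: o => //= j; rewrite (size_dseq_unary j). Qed.

Let assign12E x (j : 'I_(n x)) :
  assign12 x j = enc_option (@enc_vertex _) (combined_assign (S1 x) (S2 x) j).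
Proof.
rewrite /assign12 assign1E assign2E nonnil_option ffunE.
by case: (assign (S1 x) j).
Qed.

(** A client of [k] in the combination is served in [S1], so its entry is not [Nil]: the first entry
    other than [Nil] belongs to the first such client. *)
Let anchor12E x (k : 'I_(n x)) :
  anchor12 x k = enc_option (@enc_vertex _) (anchor (S1 x) (S2 x) k).
Proof.
rewrite /anchor12 /anchor /mkseq -val_enum_ord -map_comp.
elim: (enum _) => //= j s IH.
rewrite /first /= /served assign12E nonnil_option eq_option assign1E.
by case: eqP => [/combined_assignP[y jy _]|_] /=; [rewrite jy | exact: IH].
Qed.

Let attached12E x (a b : 'I_(n x)) :
  attached12 x a b = attached (S1 x) (S2 x) a b.
Proof. by rewrite /attached12 tree1E anchor12E nonnil_option eq_option. Qed.

Lemma ptime_combined :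
  ptime i (fun x => enc_solution (ConCP X) (combined (S1 x) (S2 x))).
Proof.
pose o x := Cons (dlist (mkseq (fun k => enc_bool (nonnil (anchor12 x k))) (n x)))
  (Cons (dlist (mkseq (assign12 x) (n x)))
  (Cons (dlist (mkseq (fun k =>
           enc_bool (nonnil (tree1 x k) || nonnil (anchor12 x k))) (n x)))
    (dlist (mkseq (fun a =>
       dlist (mkseq (fun b => enc_bool (edge12 x a b)) (n x))) (n x))))).
apply: (eq_ptime (o := o)) => [|x].
  apply: ptime_cons; first exact: ptime_mkseq p_n (ptime_nonnil p_anchor12).
  apply: ptime_cons; first exact: ptime_mkseq p_n p_assign12.
  apply: ptime_cons; apply: ptime_mkseq p_n _.
    exact: ptime_orb (ptime_nonnil p_tree1) (ptime_nonnil p_anchor12).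
  exact: (p_mkseq2 (g := fun x a b => enc_bool (edge12 x a b))).
congr (Cons _ (Cons _ (Cons _ _))); apply/esym/enc_funE => k.
- by rewrite inE anchor12E nonnil_option.
- by rewrite assign12E.
- by rewrite !inE tree1E anchor12E nonnil_option.
- by apply: enc_funE => b; rewrite /edge12 edges1E !attached12E !inE.
Qed.

End Computation.

(** * Assembling the algorithm *)

Lemma poly_time_approx_combined (R : realType) (X : variant)
    (alpha beta gcap gcard : R) :
  poly_time_approx ConPFL alpha 1 1 -> poly_time_approx (CP X) beta gcap gcard ->
  poly_time_approx (ConCP X) (alpha + 2%:R * beta) gcap gcard.
Proof.
move=> apx1 apx2.
have a_ge0 := approx_ratio_ge0 apx1; have b_ge0 := approx_ratio_ge0 apx2.
(* Programs are only specified on valid instances, so these index the families. *)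
pose T := {I : instance | valid (ConCP X) I}.
have ptime_approx P b gca gcr : poly_time_approx P b gca gcr ->
    (forall x : T, valid P (sval x)) ->
  exists S : forall x : T, solution (nV (sval x)),
    ptime (fun x => enc_instance P (sval x)) (fun x => enc_solution P (S x)) /\
    forall x, feasible P (S x) (gca : R) gcr /\
    forall Sopt : solution (nV (sval x)), optimal R P Sopt ->
      ratr (cost P (S x)) <= b * ratr (cost P Sopt).
  move=> [c [p H]] v.
  (* Choosing the returned solutions once and for all makes running time and guarantee speak of the
     same family. *)
  exists (fun x => projT1 (cid (H _ (v x)))); split; last first.
      by move=> x; case: cid => /= S [t [_ _ fS aS]].
  have [k pk] := poly_nat_le_exp p.
  exists c, (fun x => p.[dsize (enc_instance P (sval x))]); split.
    by exists k => x; exact: pk (dsize_gt0 _).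
  by move=> x; case: cid => /= S [t [? ? _ _]]; exists t.
have [|S1 [pS1 H1]] := ptime_approx _ _ _ _ apx1.
  by move=> [I [? ? ? ?]].
have [|S2 [pS2 H2]] := ptime_approx _ _ _ _ apx2.
  by move=> [I [? ? ? ?]].
pose i (x : T) := enc_instance (ConCP X) (sval x).
(* The ConPFL input arises by blanking capacities and bound; the CP[X] input is literally that of
   ConCP[X]. *)
have pi1 : ptime i (fun x => enc_instance ConPFL (sval x)).
  have ti := ptime_tail (ptime_id i); have tti := ptime_tail ti.
  exact: (ptime_cons (ptime_head (ptime_id i)) (ptime_cons (ptime_head ti)
    (ptime_cons (ptime_head tti) (ptime_cons (ptime_nil i) (ptime_nil i))))).
have [c [b [[k pb] H]]] := ptime_combined (ptime_comp pi1 pS1) pS2.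
have [p pE] := exp_as_poly k.
exists c, p => I vI; pose x : T := exist _ I vI.
have [t cmp tb] := H x; have [f1 a1] := H1 x; have [f2 a2] := H2 x.
exists (combined (S1 x) (S2 x)), t; split=> //.
- by rewrite pE (leq_trans tb).
- exact: (combined_feasible f1 f2).
- by move=> Sopt; exact: (combined_approx a_ge0 b_ge0 vI f1 f2 a1 a2).
Qed.

Theorem theorem3 (R : realType) (X : variant) (v : violation)
    (alpha beta gamma : R) :
  poly_time_approx ConPFL alpha 1 1 ->
  poly_time_approx_violating (CP X) v beta gamma ->
  poly_time_approx_violating (ConCP X) v (alpha + 2%:R * beta) gamma.
Proof. by case: v; exact: poly_time_approx_combined. Qed.
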